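(* Let $d \geq 2$ and $n \geq d+1$ be integers. Then $$\min\{a(X) \mid X \subset \mathbb{R}^d,\ \operatorname{aff} X = \mathbb{R}^d,\ X \text{ is in convex position},\ |X| = n\} = n + \frac{d(d-1)}{2} - 1 .$$
   Context: Let $X=\{x_1,\dots,x_n\}\subset\mathbb{R}^d$ be a finite set (with $x_i\neq x_j$ for $i\ne j$) whose affine hull is $\mathbb{R}^d$, and let $P=\operatorname{conv}X$. Two distinct points $x_i,x_j\in X$ are called antipodal (in $X$) if there are different parallel supporting hyperplanes $H',H''$ of $P$ with $x_i\in H'$ and $x_j\in H''$. $a(X)$ denotes the number of (unordered) antipodal pairs $\{x_i,x_j\}$ of $X$. $X$ is in convex position if $X\subset \operatorname{bd}P$ (so points of $X$ need not be vertices of $P$). *)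

(* Defs.v *)
From mathcomp Require Import all_boot all_order all_algebra.
From mathcomp Require Import finmap.
From mathcomp Require Import all_classical all_reals all_analysis.

Set Implicit Arguments.
Unset Strict Implicit.
Unset Printing Implicit Defensive.

Import Order.TTheory GRing.Theory Num.Theory.
Import numFieldNormedType.Exports.

Local Open Scope classical_set_scope.
Local Open Scope ring_scope.

Section AntipodalPairs.
Context {R : realType} {d : nat}.
Implicit Types (x y z u v : 'rV[R]_d) (X Y : {fset 'rV[R]_d}).
Implicit Types H P : set 'rV[R]_d.

Definition dotv u z : R := \sum_(i < d) u ord0 i * z ord0 i.

Definition affine_hull X : set 'rV[R]_d :=
  [set z | exists l : 'rV[R]_d -> R,
     \sum_(x <- X) l x = 1 /\ z = \sum_(x <- X) l x *: x].

Definition convex_hull X : set 'rV[R]_d :=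
  [set z | exists l : 'rV[R]_d -> R,
     [/\ forall x, x \in X -> 0 <= l x,
         \sum_(x <- X) l x = 1
       & z = \sum_(x <- X) l x *: x]].

Definition boundary P : set 'rV[R]_d := closure P `\` interior P.

Definition hyperplane u (c : R) : set 'rV[R]_d := [set z | dotv u z = c].

Definition supporting_hyperplane P H : Prop :=
  exists u (c : R),
    [/\ u != 0, H = hyperplane u c, P `&` H !=set0
      & forall z, P z -> dotv u z <= c].

(* Meant for hyperplanes only; a hyperplane is parallel to itself. *)
Definition parallel H1 H2 : Prop := exists v, H2 = [set z + v | z in H1].

Definition antipodal X x y : Prop :=
  [/\ x \in X, y \in X, x != y
    & exists H1 H2,
        [/\ supporting_hyperplane (convex_hull X) H1,
            supporting_hyperplane (convex_hull X) H2,
            parallel H1 H2, H1 <> H2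
          & H1 x /\ H2 y]].

(* Unordered pairs: antipodal is symmetric, so each pair is counted once, as a
   two-element subset of X. *)
Definition antipodal_pairs X : {fset {fset 'rV[R]_d}} :=
  [fset Y in fpowerset X |
     `[< exists x y, Y = [fset x; y]%fset /\ antipodal X x y >]]%fset.

Definition num_antipodal_pairs X : nat := #|` antipodal_pairs X|.

(* Points of X are not required to be vertices of the polytope convex_hull X. *)
Definition convex_position X : Prop := [set` X] `<=` boundary (convex_hull X).

End AntipodalPairs.

Definition is_minimum (A : set nat) (m : nat) : Prop :=
  A m /\ forall k, A k -> (m <= k)%N.

(* Main.v *)
(* For u != 0 let F(u) be the set of points of X maximizing u. The antipodal
   graph joins F(u) completely to F(-u) for every u, and the claim is that it
   has at least n - 1 + C(d,2) edges. This is proved by induction on d, for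
   configurations in which only boundary points count as vertices.

   A point x with F(u) <> {x} for all u can be deleted: this loses a vertex and
   at least one edge. Otherwise all points are vertices of the hull. Take a
   facet F(u0) and p in F(-u0), and let w point from the hull outwards at p, so
   that u.w > 0 on the normal cone of p. Directions u orthogonal to w describe
   the projection of X along w, a (d-1)-dimensional configuration whose graph
   avoids p. The vertices other than p seen from directions outside the
   interiors of the normal cone of p and of its opposite form a connected graph
   containing this one, so each vertex added to it costs at least one edge; every
   remaining vertex is a leaf attached to p; and p has at least d neighbours which
   are not leaves. Adding up, the number of edges minus the number of vertices
   grows by at least d - 1 = C(d,2) - C(d-1,2).

   Equality: a simplex together with points in the relative interior of one
   facet, each antipodal to the opposite vertex only. *)
Require Import Defs.
From mathcomp Require Import all_boot all_order all_algebra.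
From mathcomp Require Import finmap.
From mathcomp Require Import all_classical all_reals all_analysis.
From mathcomp Require Import ring lra zify.

Import Order.TTheory GRing.Theory Num.Theory.
Import numFieldNormedType.Exports.

Set Implicit Arguments.
Unset Strict Implicit.
Unset Printing Implicit Defensive.

Local Open Scope ring_scope.

(** * Linear functionals *)

Section Dot.
Context {R : realType} {d : nat}.
Implicit Types u v z : 'rV[R]_d.

Lemma dotvE u z : dotv u z = (u *m z^T) ord0 ord0.
Proof. by rewrite mxE; apply: eq_bigr => i _; rewrite mxE. Qed.

Lemma dotvC u z : dotv u z = dotv z u.
Proof. by apply: eq_bigr => i _; rewrite mulrC. Qed.

Lemma dotvDl u v z : dotv (u + v) z = dotv u z + dotv v z.
Proof. by rewrite !dotvE mulmxDl mxE. Qed.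

Lemma dotvNl u z : dotv (- u) z = - dotv u z.
Proof. by rewrite !dotvE mulNmx mxE. Qed.

Lemma dotvZl c u z : dotv (c *: u) z = c * dotv u z.
Proof. by rewrite !dotvE -scalemxAl mxE. Qed.

Lemma dotvDr z u v : dotv z (u + v) = dotv z u + dotv z v.
Proof. by rewrite dotvC dotvDl !(dotvC z). Qed.

Lemma dotvNr z u : dotv z (- u) = - dotv z u.
Proof. by rewrite dotvC dotvNl (dotvC z). Qed.

Lemma dotvZr z c u : dotv z (c *: u) = c * dotv z u.
Proof. by rewrite dotvC dotvZl (dotvC z). Qed.

Lemma dotv0r u : dotv u 0 = 0.
Proof. by rewrite dotvE trmx0 mulmx0 mxE. Qed.

Lemma dotv0l u : dotv 0 u = 0.
Proof. by rewrite dotvC dotv0r. Qed.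

Lemma dotv_sumr (J : Type) (r : seq J) (P : pred J) u (F : J -> 'rV[R]_d) :
  dotv u (\sum_(j <- r | P j) F j) = \sum_(j <- r | P j) dotv u (F j).
Proof.
by elim/big_rec2: _ => [|j x y _ <-]; rewrite ?dotv0r ?dotvDr.
Qed.

Lemma dotv_gt0 u : u != 0 -> 0 < dotv u u.
Proof.
move=> u0; have sq0 (i : 'I_d) : true -> 0 <= u ord0 i * u ord0 i.
  by rewrite -expr2 sqr_ge0.
rewrite lt_neqAle sumr_ge0 // andbT eq_sym; apply: contraNN u0 => /eqP uu0.
apply/eqP/rowP => i; rewrite mxE.
have := uu0; rewrite /dotv => /eqP; rewrite psumr_eq0 // => /allP/(_ i).
by rewrite mem_index_enum => /(_ isT); rewrite mulf_eq0 orbb => /eqP.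
Qed.

End Dot.

(** Fewer than [k] vectors do not span, so the kernel of their transposed matrix is nonzero. *)
Lemma orthogonal_exists (R : realType) (k : nat) (I : finType) (S : {set I})
    (b : I -> 'rV[R]_k) :
  (#|S| < k)%N -> exists2 v, v != 0 & {in S, forall i, dotv v (b i) = 0}.
Proof.
move=> Sk; pose M := \matrix_(i < #|S|) b (enum_val i).
have : kermx M^T != 0.
  rewrite kermx_eq0 /row_free mxrank_tr; apply/eqP => rM.
  by have := rank_leq_row M; rewrite rM leqNgt Sk.
case/rowV0Pn => v /sub_kermxP vM v0; exists v => // i iS.
have /matrixP/(_ ord0 (enum_rank_in iS i)) := vM.
rewrite [in X in X -> _]mxE [in X in _ = X -> _]mxE => vM0.
rewrite dotvE mxE -[RHS]vM0; apply: eq_bigr => l _.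
by rewrite !mxE enum_rankK_in.
Qed.

Lemma free_basis (F : fieldType) (m n r : nat) (A : 'M[F]_(m, n)) :
  \rank A = r -> exists2 B : 'M[F]_(r, n), row_free B & (B :=: A)%MS.
Proof.
by move=> <-; exists (row_base A); [exact: row_base_free | exact: eq_row_base].
Qed.

(** The rows of [B] are a basis of the orthogonal complement of [w]; dually, [B^T] gives coordinates
    for the projection along [w]. *)
Lemma hyperplane_param (R : realType) (k : nat) (w : 'rV[R]_k.+1) :
  w != 0 -> exists B : 'M[R]_(k, k.+1),
    [/\ forall u : 'rV_k, u != 0 -> u *m B != 0, forall u, dotv (u *m B) w = 0
      & forall u, dotv u w = 0 -> exists u', u = u' *m B].
Proof.
move=> w0; have rw : \rank (kermx w^T) = k.
  by rewrite mxrank_ker mxrank_tr rank_rV w0 subSS subn0.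
have [B fB eB] := free_basis rw; exists B; split=> [u u0|u|u uw].
- by apply: contra_neq u0 => uB; rewrite -(mulmxKp fB u) uB mul0mx.
- by rewrite dotvE (_ : _ *m _ = 0) ?mxE //; apply/sub_kermxP; rewrite -eB submxMl.
- apply/submxP; rewrite eB; apply/sub_kermxP/matrixP => i j.
  by rewrite !ord1 -dotvE uw mxE.
Qed.

(** * Edge counts along a growing vertex set *)

Section Graph.
Context {I : finType}.
Implicit Types (C V : {set I}) (E : {set {set I}}).

(** Vertices are added one at a time: the edge joining the new vertex [j] to [C] was not contained
    in [C], so edges grow at least as fast as vertices. *)
Lemma connected_growth E V0 V : V0 \subset V ->
  (forall C, V0 \subset C -> C \proper V ->
     exists i j, [/\ i \in C, j \in V :\: C & [set i; j] \in E]) ->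
  (#|[set e in E | e \subset V0]| + #|V :\: V0| <= #|[set e in E | e \subset V]|)%N.
Proof.
move=> V0V conn; suff H m C : #|V :\: C| = m -> V0 \subset C -> C \subset V ->
    (#|[set e in E | e \subset C]| + m <= #|[set e in E | e \subset V]|)%N.
  exact: H.
elim: m C => [|m IH] C cm V0C CV.
  rewrite addn0; suff -> : C = V by [].
  by apply/eqP; rewrite finset.eqEsubset CV -finset.setD_eq0 -cards_eq0 cm.
have [|i [j [iC jC ijE]]] := conn C V0C.
  by rewrite fintype.properE CV -finset.setD_eq0 -cards_eq0 cm.
have [jV jnC] := setDP jC.
have cm' : #|V :\: (j |: C)| = m.
  by have := cardsD1 j (V :\: C); rewrite jC cm finset.setDDl finset.setUC; case.
have := IH _ cm' (fintype.subset_trans V0C (subsetU1 _ _)).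
rewrite finset.subUset finset.sub1set jV CV => /(_ isT); apply: leq_trans.
rewrite addnS -addSn leq_add2r.
have -> : #|[set e in E | e \subset C]|.+1 =
          #|[set i; j] |: [set e in E | e \subset C]|.
  by rewrite cardsU1 !inE finset.subUset !finset.sub1set (negPf jnC) !andbF.
apply/subset_leq_card/fintype.subsetP => e; rewrite !inE => /orP[/eqP->|/andP[-> eC]].
  by rewrite ijE finset.subUset !finset.sub1set !inE iC eqxx orbT.
by rewrite (fintype.subset_trans eC (subsetU1 _ _)).
Qed.

End Graph.

(** * Faces and opposite points *)

Section Faces.
Context {R : realType} {k : nat} {I : finType}.
Variable a : I -> 'rV[R]_k.
Implicit Types (u v w : 'rV[R]_k) (X C : {set I}) (i j p : I).

Definition face X u : {set I} :=
  [set i in X | [forall j in X, dotv u (a j) <= dotv u (a i)]].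

(* Points on the boundary of the hull, not only its vertices. *)
Definition extreme X : {set I} :=
  [set i | `[< exists2 u, u != 0 & i \in face X u >]].

Definition opposite X i j : Prop :=
  exists2 u, u != 0 & i \in face X u /\ j \in face X (- u).

Definition opposite_pairs X : {set {set I}} :=
  [set e | `[< exists i j, e = [set i; j] /\ opposite X i j >]].

(** Affine spanning in dual form: no nonzero functional is constant on the points. *)
Definition full_dim X : Prop :=
  forall u, u != 0 -> exists i j, [/\ i \in X, j \in X & dotv u (a i) < dotv u (a j)].

Lemma faceP X u i :
  reflect (i \in X /\ {in X, forall j, dotv u (a j) <= dotv u (a i)})
          (i \in face X u).
Proof. by rewrite inE; apply: (iffP andP) => -[iX /forall_inP]. Qed.

Lemma faceNP X u i :
  reflect (i \in X /\ {in X, forall j, dotv u (a i) <= dotv u (a j)})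
          (i \in face X (- u)).
Proof.
apply: (iffP (faceP _ _ _)) => -[iX ui]; split=> // j jX.
  by have := ui j jX; rewrite !dotvNl lerN2.
by rewrite !dotvNl lerN2 ui.
Qed.

Lemma extremeP X i :
  reflect (exists2 u, u != 0 & i \in face X u) (i \in extreme X).
Proof. by rewrite finset.inE; exact: asboolP. Qed.

Lemma opposite_pairsP X (e : {set I}) :
  reflect (exists i j, e = [set i; j] /\ opposite X i j) (e \in opposite_pairs X).
Proof. by rewrite finset.inE; exact: asboolP. Qed.

Lemma face_sub X u i : i \in face X u -> i \in X.
Proof. by case/faceP. Qed.

Lemma face_eq X u i j : i \in face X u -> j \in face X u ->
  dotv u (a i) = dotv u (a j).
Proof.
by case/faceP => iX ui /faceP[jX uj]; apply/le_anti; rewrite ui // uj.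
Qed.

Lemma face_exists X u i : i \in X -> exists j, j \in face X u.
Proof.
move=> iX; case: (arg_maxP (fun j => dotv u (a j)) iX) => j jX uj.
by exists j; apply/faceP.
Qed.

Lemma face_opp_disjoint X u i : full_dim X -> u != 0 ->
  i \in face X u -> i \notin face X (- u).
Proof.
move=> fX /fX[j [l [jX lX ujl]]] /faceP[iX ui]; apply/negP => /faceNP[_ ui'].
by have := le_trans (ui l lX) (ui' j jX); rewrite leNgt ujl.
Qed.

Lemma full_dim_nonempty X u : full_dim X -> u != 0 -> exists i, i \in X.
Proof. by move=> fX /fX[i [j [iX]]]; exists i. Qed.

Lemma oppositeC X i j : opposite X i j -> opposite X j i.
Proof.
by case=> u u0 [iu ju]; exists (- u); rewrite ?oppr_eq0 ?opprK.
Qed.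

Lemma opposite_neq X i j : full_dim X -> opposite X i j -> i != j.
Proof.
move=> fX [u u0 [iu ju]]; apply: contraTneq ju => <-.
exact: face_opp_disjoint.
Qed.

(** The ratio test: [u] is tilted towards [v] until a point that gains on [p] first ties with it. *)
Lemma first_hit X u v p j0 : p \in face X u -> j0 \in X ->
    dotv v (a p) < dotv v (a j0) ->
  exists t j, [/\ 0 <= t, dotv v (a p) < dotv v (a j),
    p \in face X (u + t *: v) & j \in face X (u + t *: v)].
Proof.
move=> /faceP[pX up] j0X vj0.
pose P j := (j \in X) && (dotv v (a p) < dotv v (a j)).
(* [r j] is the time [t] at which [u + t *: v] takes equal values at [p] and [j]; up to the least
   such time [p] stays maximal. *)
pose r j := (dotv u (a p) - dotv u (a j)) / (dotv v (a j) - dotv v (a p)).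
have Pj0 : P j0 by apply/andP.
case: (arg_minP r Pj0) => j /andP[jX vj] rj; exists (r j), j.
have r0 l : P l -> 0 <= r l.
  by case/andP=> lX vl; rewrite divr_ge0 // subr_ge0 ?up // ltW.
have rj0 := r0 j _; have {}rj0 : 0 <= r j by apply: rj0; apply/andP.
have pf : p \in face X (u + r j *: v).
  apply/faceP; split=> // l lX; rewrite !dotvDl !dotvZl.
  have [vl|vl] := ltP (dotv v (a p)) (dotv v (a l)).
    have Pl : P l by apply/andP.
    have := rj l Pl; rewrite [X in _ <= X]/r ler_pdivlMr ?subr_gt0 // mulrBr.
    lra.
  by apply: lerD; [exact: up | exact: ler_wpM2l].
split=> //; apply/faceP; split=> // l lX; have [_ /(_ l lX) pl] := faceP _ _ _ pf.
apply: (le_trans pl); rewrite !dotvDl !dotvZl.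
have : r j * (dotv v (a j) - dotv v (a p)) = dotv u (a p) - dotv u (a j).
  by rewrite /r divfK // subr_eq0 gt_eqF.
rewrite mulrBr; lra.
Qed.

(** Connectedness of [0, T]: the parameters whose face meets [C] and those whose face meets [D] form
    disjoint closed sets covering the segment, so [D] cannot be left. *)
Lemma face_segment X u v (T : R) (C D : {set I}) : 0 <= T ->
    (forall t, 0 <= t <= T -> exists2 i, i \in C :|: D & i \in face X (u + t *: v)) ->
    (forall t i j, 0 <= t <= T -> i \in C -> j \in D ->
       i \in face X (u + t *: v) -> j \in face X (u + t *: v) -> False) ->
    (exists2 i, i \in D & i \in face X u) ->
  exists2 i, i \in D & i \in face X (u + T *: v).
Proof.
move=> T0 cov disj [i0 i0D i0u].
pose S (F : {set I}) : set R :=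
  (\bigcup_(i in [set i | i \in F]) [set t | i \in face X (u + t *: v)])%classic.
have clS F : closed (S F).
  apply: closed_bigcup => [|i _]; first exact: finite_finset.
  have [iX|iX] := boolP (i \in X); last first.
    rewrite [X in closed X](_ : _ = set0)%classic; first exact: closed0.
    by apply/seteqP; split=> // t /= /face_sub; rewrite (negPf iX).
  (* Membership in the face amounts to finitely many weak affine inequalities in [t]. *)
  have -> : ([set t | i \in face X (u + t *: v)] =
      \bigcap_(j in [set j | j \in X])
        [set t | 0 <= dotv u (a i - a j) + t * dotv v (a i - a j)])%classic.
    apply/seteqP; split=> t /= H.
      move=> j jX /=; have /faceP[_ /(_ j jX)] := H.
      rewrite !dotvDl !dotvZl !dotvDr !dotvNr; lra.
    apply/faceP; split=> // j jX; have := H j jX; rewrite /=.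
    rewrite !dotvDl !dotvZl !dotvDr !dotvNr; lra.
  apply: closed_bigI => j _.
  apply: (@preimage_closed _ _ (fun t : R => _ + t * _) [set x | 0 <= x]%classic).
    move=> t _; apply: cvgD; first exact: cvg_cst.
    by apply: cvgMr_tmp; exact: cvg_id.
  exact: closed_ge.
have SP t F : S F t <-> exists2 i, i \in F & i \in face X (u + t *: v).
  by split=> [[i iF it]|[i iF it]]; exists i.
have tP t : (`[0, T]%classic t) = (0 <= t <= T) :> Prop by rewrite /= in_itv.
have SDC t : (0 <= t <= T) -> S D t <-> ~ S C t.
  move=> tT; split=> [/SP[j jD jt] /SP[i iC it]|nC]; first exact: (disj t i j).
  have [i + it] := cov t tT; rewrite inE => /orP[iC|iD]; last by exists i.
  by case: nC; exists i.
suff SD : (`[0, T] `&` S D = `[0, T])%classic.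
  have : (`[0, T]%classic T) by rewrite tP T0 lexx.
  by rewrite -SD => -[_ /SP].
apply: (@segment_connected R 0 T).
- exists 0; split; first by rewrite tP lexx.
  by apply/SP; exists i0; rewrite // scale0r addr0.
- exists (~` S C)%classic; first exact/closed_openC/clS.
  by apply/seteqP; split=> t [tT H]; split=> //; move: tT; rewrite tP => /SDC; tauto.
- by exists (S D).
Qed.

End Faces.

(** * Deleting points that are not exposed vertices *)

Section Redundancy.
Context {R : realType} {k : nat} {I : finType}.
Variable a : I -> 'rV[R]_k.
Implicit Types (u v w : 'rV[R]_k) (X C : {set I}) (i j p : I).

Definition irredundant X : Prop :=
  forall i, i \in X -> exists2 u, u != 0 & face a X u = [set i].

Lemma face_ltS X u i j : face a X u = [set i] -> j \in X -> j != i ->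
  dotv u (a j) < dotv u (a i).
Proof.
move=> fi jX ji; have /faceP[iX ui] : i \in face a X u by rewrite fi set11.
rewrite lt_neqAle ui // andbT; apply: contraNneq ji => uji.
suff : j \in face a X u by rewrite fi finset.in_set1.
by apply/faceP; split=> // l /ui; rewrite uji.
Qed.

Lemma faceZ X u (c : R) : 0 < c -> face a X (c *: u) = face a X u.
Proof.
move=> c0; apply/setP => i; apply/faceP/faceP => -[iX ui]; split=> // j /ui;
  by rewrite !dotvZl ler_pM2l.
Qed.

Lemma face_neq1 X u p : full_dim a X -> u != 0 -> face a X u != [set p] ->
  exists2 i, i != p & i \in face a X u.
Proof.
move=> fX u0 fp; have [i0 i0X] := full_dim_nonempty fX u0.
have [i iu] := face_exists a u i0X; apply: contrapT => H; case/eqP: fp.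
have H' j : j \in face a X u -> j = p.
  by move=> ju; apply/eqP; apply/negPn/negP => jp; apply: H; exists j.
by apply/setP => j; rewrite finset.in_set1; apply/idP/eqP => [/H'//|->]; rewrite -(H' i iu).
Qed.

Lemma face_setD1 X x u y : y != x -> y \in face a X u ->
  face a (X :\ x) u = face a X u :\ x.
Proof.
move=> yx yu; have /faceP[yX uy] := yu.
apply/setP => i; rewrite in_setD1; apply/faceP/andP.
  rewrite in_setD1 => -[/andP[ix iX] ui]; split=> //; apply/faceP; split=> // j jX.
  have [jE|jx] := eqVneq j x; last by apply: ui; rewrite in_setD1 jx.
  by apply: le_trans (uy j jX) (ui y _); rewrite in_setD1 yx.
move=> [ix /faceP[iX ui]]; split; first by rewrite in_setD1 ix.
by move=> j /setD1P[_ /ui].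
Qed.

(** As [x] is never the sole maximizer, deleting it only removes [x] from each face. If [x] is
    extreme, its pair with an opposite point is lost; otherwise no extreme index is lost. *)
Lemma redundant_remove X x c : full_dim a X -> x \in X ->
    (forall u, u != 0 -> face a X u != [set x]) ->
  full_dim a (X :\ x) /\
  ((#|extreme a (X :\ x)| + c <= #|opposite_pairs a (X :\ x)| + 1)%N ->
   (#|extreme a X| + c <= #|opposite_pairs a X| + 1)%N).
Proof.
move=> fX xX red.
have fx u : u != 0 -> face a (X :\ x) u = face a X u :\ x.
  by move=> u0; have [y yx yu] := face_neq1 fX u0 (red u u0); apply: face_setD1 yu.
have opsub i j : opposite a (X :\ x) i j -> [/\ opposite a X i j, i != x & j != x].
  case=> u u0 [iu ju]; move: iu ju; rewrite !fx ?oppr_eq0 // => /setD1P[ix iu] /setD1P[jx ju].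
  by split=> //; exists u.
split.
  move=> u u0; have [y yx yu] := face_neq1 fX u0 (red u u0).
  have Nu0 : - u != 0 by rewrite oppr_eq0.
  have [z zx zu] := face_neq1 fX Nu0 (red _ Nu0).
  have /faceP[yX uy] := yu; have /faceNP[zX uz] := zu.
  exists z, y; rewrite !in_setD1 yx zx yX zX; split=> //.
  rewrite lt_neqAle uz // andbT; apply/negP => /eqP e.
  have := face_opp_disjoint fX u0 yu; case/negP; apply/faceNP; split=> // j /uz.
  by rewrite e.
have subE : opposite_pairs a (X :\ x) \subset opposite_pairs a X.
  apply/fintype.subsetP => e /opposite_pairsP[i [j [-> /opsub[ho _ _]]]].
  by apply/opposite_pairsP; exists i, j.
have ext i : i != x -> i \in extreme a X -> i \in extreme a (X :\ x).
  move=> ix /extremeP[u u0 iu]; apply/extremeP; exists u => //.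
  by rewrite fx // in_setD1 ix.
have [xe|xe] := boolP (x \in extreme a X).
  move=> H; rewrite (cardsD1 x) xe.
  have {H} : (#|extreme a X :\ x| + c <= #|opposite_pairs a (X :\ x)| + 1)%N.
    apply: leq_trans H; rewrite leq_add2r; apply/subset_leq_card/fintype.subsetP => i.
    by rewrite in_setD1 => /andP[]; exact: ext.
  suff : (#|opposite_pairs a (X :\ x)| < #|opposite_pairs a X|)%N by lia.
  apply: proper_card; apply/properP; split=> //.
  have /extremeP[u u0 xu] := xe.
  have [y yu] := face_exists a (- u) xX.
  exists [set x; y]; first by apply/opposite_pairsP; exists x, y; split=> //; exists u.
  apply/opposite_pairsP => -[i [j [e /opsub[_ ix jx]]]].
  by have /setP/(_ x) := e; rewrite !inE eqxx ![x == _]eq_sym (negPf ix) (negPf jx).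
move=> H; apply: leq_trans (leq_trans H _); last by rewrite leq_add2r subset_leq_card.
rewrite leq_add2r; apply/subset_leq_card/fintype.subsetP => i ie; apply: ext => //.
by apply: contraNneq xe => <-.
Qed.

Lemma reversed_direction X v p : full_dim a X -> v != 0 ->
  exists j (c : R), j \in X /\ dotv (c *: v) (a p) < dotv (c *: v) (a j).
Proof.
move=> fX v0; have [i [j [iX jX ij]]] := fX v v0.
have [pj|jp] := ltP (dotv v (a p)) (dotv v (a j)).
  by exists j, 1; rewrite scale1r.
exists i, (-1); split=> //.
by rewrite !dotvZl !mulN1r ltrN2 (lt_le_trans ij).
Qed.

End Redundancy.

(** * Existence of a facet *)

Section Facet.
Context {R : realType} {k : nat} {I : finType}.
Variable a : I -> 'rV[R]_k.+1.
Implicit Types (u v w : 'rV[R]_k.+1) (X C : {set I}) (i j p : I).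

(** A face with too few points is tilted, keeping all its points, until it gains another one. *)
Lemma facet_exists X : full_dim a X ->
  exists2 u, u != 0 & (k.+1 <= #|face a X u|)%N.
Proof.
move=> fX; suff H n : (n <= k.+1)%N -> exists2 u, u != 0 & (n <= #|face a X u|)%N by exact: H.
elim: n => [_|n IH nk].
  by exists (const_mx 1) => //; apply/eqP => /rowP/(_ ord0)/eqP; rewrite !mxE oner_eq0.
have [u u0 nu] := IH (ltnW nk).
have [nu'|un] := ltnP n #|face a X u|; first by exists u.
have [x xX] := full_dim_nonempty fX u0; have [i0 i0u] := face_exists a u xX.
(* The slot of [i0], whose difference would vanish, holds [u] itself: [v] is then orthogonal to [u],
   which keeps the tilted functional nonzero. *)
have [v v0 vb] := orthogonal_exists (fun i => if i == i0 then u else a i - a i0)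
  (leq_ltn_trans un nk).
have [j0 [c [j0X vj0]]] := reversed_direction i0 fX v0.
have [t [j [t0 vj i0t jt]]] := first_hit i0u j0X vj0.
have vi i : i \in face a X u -> dotv v (a i) = dotv v (a i0).
  have [->//|ii0] := eqVneq i i0; move=> iu; have := vb i iu; rewrite (negPf ii0).
  by rewrite dotvDr dotvNr => /eqP; rewrite subr_eq0 => /eqP.
have vu : dotv v u = 0 by have := vb i0 i0u; rewrite eqxx.
exists (u + t *: (c *: v)).
  apply/eqP => /(congr1 (dotv^~ u)); rewrite dotvDl !dotvZl vu !mulr0 addr0 dotv0l.
  by move/eqP; rewrite gt_eqF // dotv_gt0.
have -> : n = #|face a X u| by apply/eqP; rewrite eqn_leq nu un.
apply: proper_card; apply/properP; split.
  apply/fintype.subsetP => i iu; apply/faceP; split; first exact: face_sub iu.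
  move=> l lX; have /faceP[_ /(_ l lX)] := i0t.
  by rewrite !dotvDl !dotvZl (vi i iu) (face_eq iu i0u).
by exists j => //; apply/negP => ju; move: vj; rewrite !dotvZl (vi j ju) ltxx.
Qed.

End Facet.

(** * The rim of a vertex and the neighbours of the vertex in it *)

Section Rim.
Context {R : realType} {k : nat} {I : finType}.
Variable a : I -> 'rV[R]_k.
Implicit Types (u v w : 'rV[R]_k) (X C : {set I}) (i j p : I).

(* Neither u nor - u lies in the interior of the normal cone of p. *)
Definition avoids X p u : Prop :=
  [/\ u != 0, face a X u != [set p] & face a X (- u) != [set p]].

Definition rim X p : {set I} :=
  [set i | (i != p) && `[< exists2 u, avoids X p u & i \in face a X u >]].

Lemma rimP X p i :
  reflect (i != p /\ exists2 u, avoids X p u & i \in face a X u) (i \in rim X p).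
Proof. by rewrite finset.inE; apply: (iffP andP) => -[? /asboolP]. Qed.

Lemma avoidsN X p u : avoids X p u -> avoids X p (- u).
Proof. by case=> u0 pu pNu; split; rewrite ?oppr_eq0 ?opprK. Qed.

Lemma avoids_rim X p u : full_dim a X -> avoids X p u ->
  exists2 i, i \in rim X p & i \in face a X u.
Proof.
move=> fX av; have [u0 pu _] := av; have [i ip iu] := face_neq1 fX u0 pu.
by exists i => //; apply/rimP; split=> //; exists u.
Qed.

(** This is [#|X|] times the vector from the centroid of the points to [a p]. *)
Definition inner_dir X p : 'rV[R]_k := \sum_(j in X) (a p - a j).

Lemma inner_dir_gt0 X p u : full_dim a X -> u != 0 -> p \in face a X u ->
  0 < dotv u (inner_dir X p).
Proof.
move=> fX u0 /faceP[pX up]; rewrite dotv_sumr.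
have [i [j [iX jX uij]]] := fX u u0.
rewrite (bigD1 i) //= ltr_pwDl //.
  by rewrite dotvDr dotvNr subr_gt0 (lt_le_trans uij) // up.
by apply: sumr_ge0 => l /andP[lX _]; rewrite dotvDr dotvNr subr_ge0 up.
Qed.

Lemma orthogonal_avoids X p u : full_dim a X -> u != 0 ->
  dotv u (inner_dir X p) = 0 -> avoids X p u.
Proof.
move=> fX u0 uw; split=> //; apply/eqP => fp.
  have /(inner_dir_gt0 fX u0) : p \in face a X u by rewrite fp set11.
  by rewrite uw ltxx.
have Nu0 : - u != 0 by rewrite oppr_eq0.
have /(inner_dir_gt0 fX Nu0) : p \in face a X (- u) by rewrite fp set11.
by rewrite dotvNl uw oppr0 ltxx.
Qed.

(* Translating u by a multiple of - v, where v is interior to the normal cone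
   of p, leads to the hyperplane orthogonal to inner_dir without entering the
   interiors of that cone and of its opposite. *)
Lemma rim_connected X p v C : full_dim a X -> face a X v = [set p] ->
    (forall u i, u != 0 -> dotv u (inner_dir X p) = 0 -> i \in face a X u -> i \in C) ->
    C \proper rim X p ->
  exists i j, [/\ i \in C, j \in rim X p :\: C & opposite a X i j].
Proof.
move=> fX fv CH /properP[CV [j0 j0V j0C]]; set w := inner_dir X p in CH *.
have /faceP[pX vp] : p \in face a X v by rewrite fv set11.
apply: contrapT => nE.
have nopp i j : i \in C -> j \in rim X p -> j \notin C -> ~ opposite a X i j.
  by move=> iC jV jC o; apply: nE; exists i, j; rewrite finset.in_setD jC.
have v0 : v != 0.
  have /rimP[jp [u _ ju]] := j0V; apply/eqP => v0.
  have : j0 \in face a X v.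
    by apply/faceP; split=> [|l lX]; [exact: face_sub ju | rewrite v0 !dotv0l].
  by rewrite fv finset.in_set1 (negPf jp).
have vw : 0 < dotv v w by apply: inner_dir_gt0 => //; rewrite fv set11.
(* If [u] is negative on [w], then [- u] is used instead; a rim point maximizing it is opposite to
   [j0], hence outside [C]. *)
have [u [j [av uw ju jV jC]]] : exists u j, [/\ avoids X p u, 0 <= dotv u w,
    j \in face a X u, j \in rim X p & j \notin C].
  have /rimP[jp [u av ju]] := j0V.
  have [uw|uw] := leP 0 (dotv u w); first by exists u, j0.
  have [j jV jNu] := avoids_rim fX (avoidsN av).
  exists (- u), j; split=> //; [exact: avoidsN | by rewrite dotvNl oppr_ge0 ltW |].
  apply/negP => jC; apply: (nopp j j0) => //; apply: oppositeC.
  by exists u => //; case: av.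
have [u0 pu _] := av.
(* [T] makes [u + T *: (- v)] orthogonal to [w], where [CH] applies. *)
set T := dotv u w / dotv v w.
have T0 : 0 <= T by rewrite divr_ge0 // ltW.
have avt t : 0 <= t <= T -> avoids X p (u + t *: (- v)).
  move=> /andP[t0 tT].
  have ut0 : u + t *: (- v) != 0.
    apply/eqP => /eqP; rewrite scalerN subr_eq0 => /eqP uE.
    move: pu; rewrite uE faceZ ?fv ?eqxx // lt_neqAle t0 andbT.
    by apply: contraNneq u0 => t0'; rewrite uE -t0' scale0r.
  split=> //; apply/eqP => fp.
    (* Subtracting a multiple of [v], which is maximal at [p], favours [i] over [p], so the
       maximizer [i] of [u] still ties with [p]. *)
    have [i ip /faceP[iX ui]] := face_neq1 fX u0 pu.
    have pt : p \in face a X (u + t *: (- v)) by rewrite fp set11.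
    have : i \in face a X (u + t *: (- v)); last by rewrite fp finset.in_set1 (negPf ip).
    apply/faceP; split=> // l lX; have /faceP[_ /(_ l lX)] := pt.
    move/le_trans; apply; rewrite !dotvDl !dotvZl !dotvNl.
    by have := ui p pX; have := ler_wpM2l t0 (vp i iX); lra.
  have Nut0 : - (u + t *: (- v)) != 0 by rewrite oppr_eq0.
  have /(inner_dir_gt0 fX Nut0) : p \in face a X (- (u + t *: (- v))).
    by rewrite fp set11.
  rewrite -/w dotvNl dotvDl dotvZl dotvNl.
  have : t * dotv v w <= dotv u w by rewrite -ler_pdivlMr.
  by rewrite mulrN; lra.
have [l lD lT] : exists2 l, l \in rim X p :\: C & l \in face a X (u + T *: (- v)).
  apply: (face_segment (C := C) T0).
  - move=> t tT; have [i iV it] := avoids_rim fX (avt t tT).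
    by exists i => //; rewrite finset.in_setU finset.in_setD iV andbT orbN.
  (* A rim point [m] maximizing the opposite functional would be joined to both [i] and [l], and one
     of these edges leaves [C]. *)
  - move=> t i l tT iC /setDP[lV lC] it lt.
    have [m mV mt] := avoids_rim fX (avoidsN (avt t tT)).
    have [t0 _ _] := avt t tT.
    have [mC|mC] := boolP (m \in C).
      by apply: (nopp m l) => //; apply: oppositeC; exists (u + t *: (- v)).
    by apply: (nopp i m) => //; exists (u + t *: (- v)).
  - by exists j => //; rewrite finset.in_setD jC.
have [uT0 _ _] : avoids X p (u + T *: (- v)) by apply: avt; rewrite T0 lexx.
have [_] := setDP lD; case/negP; apply: CH lT => //.
by rewrite dotvDl dotvZl dotvNl mulrN /T divfK ?subrr // gt_eqF.
Qed.

(* Some facet has all its points opposite to p. If one of them, l, is not in the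
   rim, then - z is interior to the normal cone of p for some z selecting l only.
   Were there fewer than k neighbours y of p in the rim, a line z + t s with s
   orthogonal to all a l - a y would meet the boundary of the opposite cone at a
   point whose face contains none of these y. *)
Lemma rim_degree X p u0 : (1 < k)%N -> full_dim a X -> irredundant a X ->
    u0 != 0 -> (k <= #|face a X u0|)%N -> p \in face a X (- u0) ->
  (k <= #|[set i in rim X p | `[< opposite a X i p >]]|)%N.
Proof.
move=> k1 fX irr u0n0 ku0 pNu0; set N := [set i in _ | _].
have NP i : reflect (i \in rim X p /\ opposite a X i p) (i \in N).
  by rewrite [i \in N]finset.inE; apply: (iffP andP) => -[iV /asboolP].
have pX := face_sub pNu0.
have opp0 i : i \in face a X u0 -> opposite a X i p by exists u0.
have [sub|/fintype.subsetPn[l lu0 lN]] := boolP (face a X u0 \subset N).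
  by rewrite (leq_trans ku0) // subset_leq_card.
have lp : l != p := opposite_neq fX (opp0 l lu0).
have lX := face_sub lu0.
have lV : l \notin rim X p by apply: contra lN => lV; apply/NP; split=> //; exact: opp0.
have [z z0 fz] := irr l lX.
(* Otherwise [z] would avoid both cones and put [l] in the rim. *)
have fNz : face a X (- z) = [set p].
  apply: contrapT => /eqP nfz; case/negP: lV; apply/rimP; split=> //; exists z.
    by split=> //; rewrite fz; apply: contra_neq lp => /finset.set1_inj.
  by rewrite fz set11.
rewrite leqNgt; apply/negP => Nk.
have zl y : y \in N -> 0 < dotv z (a l - a y).
  case/NP => /[dup] yV /rimP[_ [u _ /face_sub yX]] _.
  rewrite dotvDr dotvNr subr_gt0; apply: face_ltS fz yX _.
  by apply: contraNneq lV => <-.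
have [s [s0 sN nz]] : exists s, [/\ s != 0, {in N, forall y, dotv s (a l - a y) = 0}
    & forall t, z + t *: s != 0].
  have [N0|/set0Pn[y yN]] := eqVneq N finset.set0.
    (* For empty [N], [s] is taken orthogonal to [z], possible since [1 < k]; otherwise [z + t *: s]
       is nonzero because it is positive on [a l - a y]. *)
    have [|s s0 sz] := @orthogonal_exists R k I [set l] (fun=> z); first by rewrite cards1.
    exists s; split=> // [y|t]; first by rewrite N0 finset.in_set0.
    apply/eqP => /(congr1 (dotv^~ z)); rewrite dotvDl dotvZl (sz l) ?set11 //.
    by rewrite mulr0 addr0 dotv0l => /eqP; rewrite gt_eqF // dotv_gt0.
  have [s s0 sN] := orthogonal_exists (fun y => a l - a y) Nk.
  exists s; split=> // t; apply/eqP => /(congr1 (dotv^~ (a l - a y))).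
  rewrite dotvDl dotvZl (sN y yN) mulr0 addr0 dotv0l => /eqP.
  by rewrite gt_eqF // zl.
have pNz : p \in face a X (- z) by rewrite fNz set11.
have [j0 [c [j0X sj0]]] := reversed_direction p fX s0.
have [t [j [t0 vj pt jt]]] := first_hit pNz j0X sj0.
set u := z + (t * - c) *: s.
have uE : - z + t *: (c *: s) = - u.
  by rewrite /u opprD -scaleNr mulrN opprK scalerA.
rewrite uE in pt jt.
have av : avoids X p u.
  split; first exact: nz.
    apply/eqP => fp; have := face_opp_disjoint (i := p) fX (nz _ : u != 0).
    by rewrite fp set11 pt => /(_ isT).
  by apply/eqP => fp; move: jt vj; rewrite fp finset.in_set1 => /eqP ->; rewrite ltxx.
(* A rim maximizer [y] of [u] is a neighbour of [p], so [u] and [z] agree on [a l - a y]; but [z] is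
   positive there and [u] is not. *)
have [y yV yu] := avoids_rim fX av.
have yN : y \in N by apply/NP; split=> //; exists u => //; case: av.
have /faceP[_ /(_ l lX)] := yu; rewrite -subr_ge0 -dotvNr -dotvDr -opprB dotvNr.
by rewrite dotvDl dotvZl (sN y yN) mulr0 addr0 oppr_ge0 leNgt zl.
Qed.

End Rim.

(** * The lower bound *)

Section Bound.
Context {R : realType} {I : finType}.
Implicit Types (X C : {set I}) (i j p : I).

Lemma irredundant_suffices k (a : I -> 'rV[R]_k) c :
    (forall X, full_dim a X -> irredundant a X ->
       (#|extreme a X| + c <= #|opposite_pairs a X| + 1)%N) ->
  forall X, full_dim a X -> (#|extreme a X| + c <= #|opposite_pairs a X| + 1)%N.
Proof.
move=> H X; have [n] := ubnP #|X|; elim: n X => // n IH X Xn fX.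
have [irr|nirr] := pselect (irredundant a X); first exact: H.
have [x xX red] : exists2 x, x \in X & forall u, u != 0 -> face a X u != [set x].
  apply: contrapT => nex; apply: nirr => i iX; apply: contrapT => nu; apply: nex.
  by exists i => // u u0; apply/eqP => fu; apply: nu; exists u.
have [fX' bound] := redundant_remove c fX xX red.
by apply: bound; apply: IH => //; rewrite (cardsD1 x) xX in Xn.
Qed.

(** On the line every direction is a positive multiple of [e] or [- e], so an irredundant [X]
    consists of at most its two ends. *)
Lemma opposite_pairs_bound1 (a : I -> 'rV[R]_1) X :
  full_dim a X -> irredundant a X ->
  (#|extreme a X| + 0 <= #|opposite_pairs a X| + 1)%N.
Proof.
move=> fX irr; pose e : 'rV[R]_1 := const_mx 1.
have e0 : e != 0 by apply/eqP => /rowP/(_ ord0)/eqP; rewrite !mxE oner_eq0.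
have [x xX] := full_dim_nonempty fX e0.
have [y yu] := face_exists a e xX; have [z zu] := face_exists a (- e) xX.
have Xyz : X \subset [set y; z].
  apply/fintype.subsetP => i iX; have [u u0 fu] := irr i iX.
  have ue : u = u ord0 ord0 *: e by apply/rowP => l; rewrite !mxE mulr1 !ord1.
  rewrite !inE; have [u_gt0|u_lt0|u_eq0] := ltgtP 0 (u ord0 ord0).
  - have : y \in face a X u by rewrite ue faceZ.
    by rewrite fu finset.in_set1 eq_sym => ->.
  - have : z \in face a X u by rewrite ue -[_ *: e]opprK -scaleNr -scalerN faceZ // oppr_gt0.
    by rewrite fu finset.in_set1 eq_sym => ->; rewrite orbT.
  - by move: u0; rewrite ue -u_eq0 scale0r eqxx.
have ext : (#|extreme a X| <= 2)%N.
  apply: leq_trans (subset_leq_card _) (_ : (#|[set y; z]| <= 2)%N); last first.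
    by rewrite cards2; case: (_ != _).
  apply/fintype.subsetP => i /extremeP[u _ /face_sub]; exact: (fintype.subsetP Xyz).
have : (0 < #|opposite_pairs a X|)%N; last by lia.
apply/card_gt0P; exists [set y; z]; apply/opposite_pairsP; exists y, z.
by split=> //; exists e.
Qed.

Lemma opposite_pairs_step k (a : I -> 'rV[R]_k.+2) X :
    (forall b : I -> 'rV[R]_k.+1, full_dim b X ->
      (#|extreme b X| + 'C(k.+1, 2) <= #|opposite_pairs b X| + 1)%N) ->
    full_dim a X -> irredundant a X ->
  (#|extreme a X| + 'C(k.+2, 2) <= #|opposite_pairs a X| + 1)%N.
Proof.
move=> IH fX irr; have [u0 u0n0 ku0] := facet_exists fX.
have [x xX] := full_dim_nonempty fX u0n0.
have [p pNu0] := face_exists a (- u0) xX.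
have deg := rim_degree (isT : (1 < k.+2)%N) fX irr u0n0 ku0 pNu0.
have pX := face_sub pNu0; have [v v0 fv] := irr p pX.
set V := rim a X p in deg; set w := inner_dir a X p.
have w0 : w != 0.
  apply/eqP => w0; have := inner_dir_gt0 fX v0 (p := p); rewrite -/w w0 dotv0r ltxx.
  by rewrite fv set11 => /(_ isT).
have [B [B0 Bw wB]] := hyperplane_param w0.
(* [b] is the projection along [w]; its functionals correspond to those orthogonal to [w]. *)
pose b i := a i *m B^T.
have dotb u i : dotv u (b i) = dotv (u *m B) (a i).
  by rewrite !dotvE trmx_mul trmxK mulmxA.
have faceb u : face b X u = face a X (u *m B).
  by apply/setP => i; apply/faceP/faceP => -[iX H]; split=> // j /H; rewrite !dotb.
have fb : full_dim b X.
  move=> u un0; have [i [j [iX jX ij]]] := fX _ (B0 u un0).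
  by exists i, j; rewrite !dotb.
have oppb i j : opposite b X i j ->
    exists2 u, u != 0 /\ dotv u w = 0 & i \in face a X u /\ j \in face a X (- u).
  by case=> u un0; rewrite !faceb mulNmx => ij; exists (u *m B); rewrite ?B0 ?Bw.
have not_p u i : u != 0 -> dotv u w = 0 -> i \in face a X u -> i \in V.
  move=> un0 uw iu; apply/rimP; split; last by exists u => //; exact: orthogonal_avoids.
  by apply: contraTneq iu => ->; apply/negP => /(inner_dir_gt0 fX un0); rewrite uw ltxx.
have extb u i : u != 0 -> dotv u w = 0 -> i \in face a X u -> i \in extreme b X.
  move=> un0 /wB[u' uE] iu; apply/extremeP; exists u'; last by rewrite faceb -uE.
  by apply: contraNneq un0 => u'0; rewrite uE u'0 mul0mx.
have V0V : extreme b X \subset V.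
  by apply/fintype.subsetP => i /extremeP[u un0]; rewrite faceb; apply: not_p; rewrite ?B0 ?Bw.
(* Edges at [p] are left out here and counted separately through [N]. *)
pose E := [set e in opposite_pairs a X | p \notin e].
have EP i j : opposite a X i j -> i \in V -> j \in V -> [set i; j] \in E.
  move=> o /rimP[ip _] /rimP[jp _]; rewrite /E finset.inE; apply/andP; split.
    by apply/opposite_pairsP; exists i, j.
  by rewrite !finset.inE negb_or ![p == _]eq_sym ip jp.
have growth : (#|[set e in E | e \subset extreme b X]| + #|V :\: extreme b X|
    <= #|[set e in E | e \subset V]|)%N.
  apply: connected_growth => // C V0C CV.
  have [|i [j [iC jC o]]] := rim_connected fX fv _ CV.
    by move=> u i un0 uw iu; apply: (fintype.subsetP V0C); exact: extb iu.
  have [jV _] := setDP jC; exists i, j; split=> //; apply: EP => //.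
  exact: (fintype.subsetP (proper_sub CV)).
have IHE : (#|opposite_pairs b X| <= #|[set e in E | e \subset extreme b X]|)%N.
  apply/subset_leq_card/fintype.subsetP => e /opposite_pairsP[i [j [-> /oppb]]].
  case=> u [un0 uw] [iu ju].
  have Nun0 : - u != 0 by rewrite oppr_eq0.
  have Nuw : dotv (- u) w = 0 by rewrite dotvNl uw oppr0.
  rewrite finset.inE finset.subUset !finset.sub1set (extb _ _ _ _ iu) // (extb _ _ _ _ ju) //=.
  by rewrite andbT EP //; [exists u | exact: not_p iu | exact: not_p ju].
pose N := [set i | `[< opposite a X i p >]].
have NP i : reflect (opposite a X i p) (i \in N).
  by rewrite [i \in N]finset.inE; exact: asboolP.
have star_inj : {in N &, injective (fun i => [set i; p])}.
  move=> i j /NP iN /NP jN /setP/(_ i).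
  rewrite !finset.inE eqxx (negPf (opposite_neq fX iN)) !orbF.
  by move/esym/eqP.
have EN : (#|[set e in E | e \subset V]| + #|N| <= #|opposite_pairs a X|)%N.
  have disj : [set e in E | e \subset V] :&: [set [set i; p] | i in N] = finset.set0.
    apply/setP => e; rewrite finset.in_set0 finset.in_setI.
    apply/negP => /andP[eE /imsetP[i _ ei]].
    by move: eE; rewrite ei !finset.inE eqxx orbT andbF.
  rewrite -(card_in_imset star_inj) -cardsUI disj cards0 addn0.
  apply/subset_leq_card/fintype.subsetP => e; rewrite finset.in_setU => /orP[].
    by rewrite finset.inE => /andP[]; rewrite finset.inE => /andP[].
  by case/imsetP => i /NP iN ->; apply/opposite_pairsP; exists i, p.
have extV : (#|extreme a X| <= 1 + #|V| + #|N :\: V|)%N.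
  apply: (@leq_trans #|p |: (V :|: (N :\: V))|); last first.
    by rewrite cardsU1 -addnA leq_add ?leq_b1 // cardsU leq_subr.
  apply/subset_leq_card/fintype.subsetP => i /extremeP[u un0 iu].
  rewrite !finset.in_setU finset.in_set1 finset.in_setD.
  have [//|ip] := eqVneq i p; have [//|iV] := boolP (i \in V) => /=.
  (* A maximizer of [u] other than [p] and outside the rim forces [- u] to select [p] alone. *)
  apply/NP; have fp : face a X (- u) = [set p].
    apply: contrapT => /eqP fp; case/negP: iV; apply/rimP; split=> //; exists u => //.
    by split=> //; apply: contraNneq ip => fu; rewrite -finset.in_set1 -fu.
  by exists u => //; rewrite fp set11.
have VN : [set i in V | `[< opposite a X i p >]] = N :&: V.
  by apply/setP => i; rewrite !finset.inE andbC.
(* The [k.+2] neighbours of [p] in the rim pay for the term [k.+1] of Pascal's rule and for the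
   vertex [p] itself. *)
have := cardsID V N; have := cardsID (extreme b X) V; have := IH b fb.
rewrite (finset.setIidPr V0V); move: deg; rewrite VN [in 'C(k.+2, 2)]binS bin1; lia.
Qed.

Theorem opposite_pairs_bound k (a : I -> 'rV[R]_k) X : full_dim a X ->
  (#|extreme a X| + 'C(k, 2) <= #|opposite_pairs a X| + 1)%N.
Proof.
elim: k a X => [|k IH] a X fX.
  (* In dimension 0 there is no nonzero functional, hence no extreme index. *)
  rewrite (_ : extreme a X = finset.set0) ?cards0 //; apply/setP => i.
  rewrite finset.in_set0; apply/negP => /extremeP[u /eqP[]].
  by apply/rowP => -[].
move: X fX; apply: irredundant_suffices => X; case: k a IH => [|k] a IH.
  exact: opposite_pairs_bound1.
by apply: opposite_pairs_step => b; apply: IH.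
Qed.

End Bound.

(** * Convex hulls and supporting hyperplanes *)

Section ConvexHull.
Context {R : realType} {d : nat}.
Implicit Types (u v x y z : 'rV[R]_d) (X : {fset 'rV[R]_d}).

(** Induction on the generators: if the functional [u] separating [b] from the tail is positive on
    [F j0], everything is projected along [F j0] onto the kernel of [u] and the induction hypothesis
    is used again. *)
Lemma farkas (J : eqType) (F : J -> 'rV[R]_d) (r : seq J) (b : 'rV[R]_d) : uniq r ->
  (exists l : J -> R,
     {in r, forall j, 0 <= l j} /\ b = \sum_(j <- r) l j *: F j) \/
  (exists u, {in r, forall j, dotv u (F j) <= 0} /\ 0 < dotv u b).
Proof.
elim: r F b => [|j0 r IH] F b.
  have [->|b0] := eqVneq b 0; first by left; exists (fun=> 0); rewrite big_nil.
  by right; exists b; rewrite dotv_gt0.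
move=> /= /andP[j0r ur].
have extend (l : J -> R) (c : R) : 0 <= c -> {in r, forall j, 0 <= l j} ->
    b = c *: F j0 + \sum_(j <- r) l j *: F j ->
    exists l' : J -> R, {in j0 :: r, forall j, 0 <= l' j} /\
      b = \sum_(j <- j0 :: r) l' j *: F j.
  move=> c0 l0 ->; exists (fun j => if j == j0 then c else l j); split=> [j|].
    by rewrite seq.inE; case: eqVneq => //= _; exact: l0.
  rewrite big_cons eqxx; congr (_ + _); apply: eq_big_seq => j jr.
  by have [jj0|//] := eqVneq j j0; rewrite -jj0 jr in j0r.
have [[l [l0 bE]]|[u [ur0 ub]]] := IH F b ur.
  by left; apply: (extend l 0) => //; rewrite scale0r add0r.
have [uj0|uj0] := leP (dotv u (F j0)) 0.
  by right; exists u; split=> // j; rewrite seq.inE => /orP[/eqP->|/ur0].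
pose c := dotv u (F j0); pose F' j := F j - (dotv u (F j) / c) *: F j0.
have c0 : c != 0 by rewrite gt_eqF.
have [[l [l0 bE]]|[v [vr vb]]] := IH F' (b - (dotv u b / c) *: F j0) ur.
  (* The weight of [F j0] is nonnegative since [u] is positive on [b] and nonpositive on the
     tail. *)
  left; apply: (extend l (dotv u b / c - \sum_(j <- r) l j * (dotv u (F j) / c))) => //.
    rewrite subr_ge0; apply: (@le_trans _ _ 0); last by rewrite divr_ge0 ?ltW.
    rewrite big_seq; apply: sumr_le0 => j jr.
    by rewrite mulr_ge0_le0 ?l0 // mulr_le0_ge0 ?ur0 // invr_ge0 ltW.
  have sumF' : \sum_(j <- r) l j *: F' j = \sum_(j <- r) l j *: F j -
      (\sum_(j <- r) l j * (dotv u (F j) / c)) *: F j0.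
    rewrite scaler_suml -sumrB; apply: eq_bigr => j _.
    by rewrite /F' scalerBr scalerA.
  have /eqP := bE; rewrite sumF' subr_eq => /eqP bE'.
  by rewrite [LHS]bE' scalerBl addrAC [RHS]addrC addrA.
(* This is [v] composed with the projection, so it vanishes on [F j0]. *)
right; exists (v - (dotv v (F j0) / c) *: u).
have vE y : dotv (v - (dotv v (F j0) / c) *: u) y =
            dotv v (y - (dotv u y / c) *: F j0).
  by rewrite dotvDl dotvNl dotvZl dotvDr dotvNr dotvZr; ring.
rewrite vE; split=> // j; rewrite seq.inE vE => /orP[/eqP->|/vr//].
by rewrite -/c divff // scale1r subrr dotv0r.
Qed.

Lemma fset_sum_eq (V : lmodType R) X x (f : 'rV[R]_d -> V) : x \in X ->
  \sum_(y <- X) (y == x)%:R *: f y = f x.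
Proof.
move=> xX; rewrite (bigD1_seq x) ?fset_uniq //= eqxx scale1r big1 ?addr0 // => y yx.
by rewrite (negPf yx) scale0r.
Qed.

Lemma fset_sum_eq1 X x : x \in X -> \sum_(y <- X) (y == x)%:R = 1 :> R.
Proof.
move=> xX; rewrite (bigD1_seq x) ?fset_uniq //= eqxx big1 ?addr0 // => y yx.
by rewrite (negPf yx).
Qed.

Lemma sub_convex_hull X x : x \in X -> convex_hull X x.
Proof.
move=> xX; exists (fun y => (y == x)%:R); split=> [y _||]; first by rewrite ler0n.
  exact: fset_sum_eq1.
by rewrite (fset_sum_eq id).
Qed.

Lemma convex_hull_le X u c z : (forall x, x \in X -> dotv u x <= c) ->
  convex_hull X z -> dotv u z <= c.
Proof.
move=> uX [l [l0 l1 ->]]; rewrite dotv_sumr -[c]mul1r -l1 mulr_suml.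
rewrite big_seq [X in _ <= X]big_seq; apply: ler_sum => x xX.
by rewrite dotvZr ler_wpM2l ?l0 ?uX.
Qed.

Lemma support_boundary X u x : x \in X -> u != 0 ->
  (forall y, y \in X -> dotv u y <= dotv u x) -> boundary (convex_hull X) x.
Proof.
move=> xX u0 ux; split; first exact/subset_closure/sub_convex_hull.
move=> /nbhs_ballP[e /= e0 xe].
(* [m] exceeds every coordinate of [u] in absolute value, so a step of [(e / m) *: u] stays in the
   sup-norm ball and yet increases [u]. *)
pose m := 1 + \sum_(i < d) `|u ord0 i|.
have m0 : 0 < m by rewrite ltr_pwDl // sumr_ge0.
have /xe/(convex_hull_le ux) : ball x e (x + (e / m) *: u).
  split=> // i j; rewrite -ball_normE /= !mxE opprD addNKr normrN normrM.
  rewrite gtr0_norm ?divr_gt0 // mulrAC ltr_pdivrMr // ltr_pM2l // !ord1.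
  by rewrite /m (bigD1 j) //= ltr_pwDl // lerDl sumr_ge0.
by rewrite dotvDr dotvZr gerDl leNgt mulr_gt0 ?divr_gt0 // dotv_gt0.
Qed.

(** By contraposition: without a supporting functional, Farkas writes every vector as a nonnegative
    combination of the [y - x], and doing so for the signed unit vectors puts a ball around [x]
    inside the hull. *)
Lemma boundary_support X x : x \in X -> boundary (convex_hull X) x ->
  exists2 u, u != 0 & forall y, y \in X -> dotv u y <= dotv u x.
Proof.
move=> xX [_ nint]; apply: contrapT => nsup; apply: nint.
have pos b : exists l : 'rV[R]_d -> R,
    {in X, forall y, 0 <= l y} /\ b = \sum_(y <- X) l y *: (y - x).
  have [//|[u [uX ub]]] := farkas (fun y => y - x) b (fset_uniq X).
  case: nsup; exists u; first by apply: contraTneq ub => ->; rewrite dotv0l ltxx.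
  by move=> y /uX; rewrite dotvDr dotvNr subr_le0.
have /choice[L LP] : forall si : bool * 'I_d, exists l : 'rV[R]_d -> R,
    {in X, forall y, 0 <= l y} /\
    (-1) ^+ si.1 *: delta_mx ord0 si.2 = \sum_(y <- X) l y *: (y - x).
  by move=> si; exact: pos.
(* [M] exceeds the total weight of these combinations, so a vector with coordinates below [M^-1]
   uses weight at most 1. *)
pose M := 1 + \sum_(y <- X) \sum_si L si y.
have M0 : 0 < M.
  by rewrite ltr_pwDl // big_seq sumr_ge0 // => y yX; rewrite sumr_ge0 // => si _; apply: (LP si).1.
apply/nbhs_ballP; exists M^-1; first by rewrite /= invr_gt0.
move=> z [_ xz].
pose D (i : 'I_d) := z ord0 i - x ord0 i.
(* Coordinate [i] of [z - x] uses the combination for the unit vector of matching sign. *)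
pose m y := \sum_i `|D i| * L (D i < 0, i) y.
have mE : z = x + \sum_(y <- X) m y *: (y - x).
  apply/eqP; rewrite addrC -subr_eq; apply/eqP.
  under eq_bigr do rewrite scaler_suml.
  rewrite exchange_big /= [LHS]row_sum_delta; apply: eq_bigr => i _.
  rewrite !mxE -/(D i) [in LHS](numEsign (D i)) mulrC -scalerA (LP (D i < 0, i)).2.
  by rewrite scaler_sumr; apply: eq_bigr => y _; rewrite scalerA.
have m_ge0 y : y \in X -> 0 <= m y.
  by move=> yX; rewrite sumr_ge0 // => i _; rewrite mulr_ge0 //; apply: (LP (_, i)).1.
have m_le1 : \sum_(y <- X) m y <= 1.
  apply: (@le_trans _ _ (\sum_(y <- X) M^-1 * \sum_si L si y)).
    rewrite big_seq [leRHS]big_seq; apply: ler_sum => y yX.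
    rewrite mulr_sumr /m.
    rewrite (eq_bigr (fun si => M^-1 * L (si.1, si.2) y)); last by case.
    rewrite -(pair_big xpredT xpredT (fun s i => M^-1 * L (s, i) y)) /= exchange_big /=.
    apply: ler_sum => i _; rewrite big_bool /=.
    have L0 s : 0 <= L (s, i) y by apply: (LP (s, i)).1.
    have MV : 0 <= M^-1 by rewrite invr_ge0 ltW.
    have Di : `|D i| <= M^-1.
      have := xz ord0 i; rewrite -ball_normE /= distrC => /ltW; exact.
    apply: (@le_trans _ _ (M^-1 * L (D i < 0, i) y)); first exact: ler_wpM2r.
    by case: (D i < 0); rewrite ?lerDl ?lerDr mulr_ge0.
  by rewrite -mulr_sumr mulrC ler_pdivrMr // mul1r lerDr ler01.
exists (fun y => m y + (1 - \sum_(y <- X) m y) * (y == x)%:R); split.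
- by move=> y yX; rewrite addr_ge0 ?m_ge0 // mulr_ge0 ?subr_ge0 ?ler0n.
- by rewrite big_split /= -mulr_sumr fset_sum_eq1 // mulr1 addrC subrK.
- under eq_bigr do rewrite scalerDl -scalerA.
  rewrite big_split /= -scaler_sumr (fset_sum_eq id) // [LHS]mE.
  have -> : \sum_(y <- X) m y *: (y - x) =
      \sum_(y <- X) m y *: y - (\sum_(y <- X) m y) *: x.
    by rewrite scaler_suml -sumrB; apply: eq_bigr => y _; rewrite scalerBr.
  by rewrite scalerBl scale1r addrCA.
Qed.

End ConvexHull.

(** * Antipodal pairs as opposite pairs of indices *)

Section Antipodal.
Context {R : realType} {d : nat} {I : finType}.
Variables (X : {fset 'rV[R]_d}) (b : I -> 'rV[R]_d).
Hypothesis XP : forall x, reflect (exists i, x = b i) (x \in X).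

Let bX i : b i \in X. Proof. by apply/XP; exists i. Qed.

(** A functional constant on [X] is constant on the affine hull, here the whole space, hence
    zero. *)
Lemma affine_hull_full_dim : affine_hull X = setT -> full_dim b [set: I].
Proof.
move=> aff u u0; apply: contrapT => nlt.
have const i j : dotv u (b i) = dotv u (b j).
  by apply/eqP; rewrite eq_le !leNgt; apply/andP; split; apply/negP => ij;
    apply: nlt; do 2!eexists; split; try exact: ij; rewrite finset.inE.
have hull z : affine_hull X z by rewrite aff.
have [i0] : exists i0 : I, True.
  have [l [l1 _]] := hull 0; apply: contrapT => nI; move: l1.
  rewrite big_seq big1 => [/eqP|x /XP[i]]; first by rewrite eq_sym oner_eq0.
  by case: nI; exists i.
have uz z : dotv u z = dotv u (b i0).
  have [l [l1 ->]] := hull z.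
  rewrite dotv_sumr -[RHS]mul1r -l1 mulr_suml big_seq [RHS]big_seq.
  by apply: eq_bigr => x /XP[i ->]; rewrite dotvZr (const i i0).
by have := dotv_gt0 u0; rewrite uz -(uz 0) dotv0r ltxx.
Qed.

Lemma face_support u i : u != 0 -> i \in face b [set: I] u ->
  supporting_hyperplane (convex_hull X) (hyperplane u (dotv u (b i))).
Proof.
move=> u0 /faceP[_ ui]; exists u, (dotv u (b i)); split=> //.
  by exists (b i); split=> //; exact: sub_convex_hull.
by move=> z; apply: convex_hull_le => x /XP[j ->]; apply: ui; rewrite finset.inE.
Qed.

Lemma support_face u c i :
    (forall z, convex_hull X z -> dotv u z <= c) -> dotv u (b i) = c ->
  i \in face b [set: I] u.
Proof.
move=> uc ui; apply/faceP; split=> [|j _]; first by rewrite finset.inE.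
by rewrite ui; apply/uc/sub_convex_hull.
Qed.

(** The part [h] of [u2] orthogonal to [u1] is a direction inside the first hyperplane, so [u2]
    vanishes on it and [h] is zero. *)
Lemma parallel_hyperplanes (u1 u2 : 'rV[R]_d) c1 c2 x1 : u1 != 0 ->
    dotv u1 x1 = c1 -> parallel (hyperplane u1 c1) (hyperplane u2 c2) ->
  exists q, u2 = q *: u1.
Proof.
move=> u10 x1c [v H2]; pose q := dotv u2 u1 / dotv u1 u1; pose h := u2 - q *: u1.
have uu : dotv u1 u1 != 0 by rewrite gt_eqF ?dotv_gt0.
have hu1 : dotv h u1 = 0 by rewrite dotvDl dotvNl dotvZl divfK // subrr.
have u2z z : dotv u1 z = c1 -> dotv u2 (z + v) = c2.
  by move=> zc; have : hyperplane u2 c2 (z + v) by rewrite H2; exists z.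
have u2h : dotv u2 h = 0.
  have /u2z : dotv u1 (x1 + h) = c1 by rewrite dotvDr dotvC [dotv u1 h]dotvC hu1 addr0 dotvC.
  by have := u2z _ x1c; rewrite !dotvDr; lra.
exists q; apply/eqP; rewrite -subr_eq0 -/h; apply/negPn/negP => /dotv_gt0.
by rewrite {1}/h dotvDl dotvNl dotvZl u2h dotvC hu1 mulr0 subrr ltxx.
Qed.

(** Normals of parallel hyperplanes are proportional: a negative factor gives an opposite pair, a
    positive one would make the hyperplanes coincide. *)
Lemma oppositeP i j : injective b -> full_dim b [set: I] ->
  opposite b [set: I] i j <-> antipodal X (b i) (b j).
Proof.
move=> binj fX; split=> [oij|[_ _ ij [H1 [H2 [S1 S2 par neq [Hi Hj]]]]]].
  split=> //; first by rewrite (inj_eq binj) (opposite_neq fX oij).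
  have [u u0 [iu ju]] := oij.
  exists (hyperplane u (dotv u (b i))), (hyperplane (- u) (dotv (- u) (b j))).
  split=> //; try exact: face_support; first by apply: face_support; rewrite ?oppr_eq0.
    exists (b j - b i); apply/seteqP; split=> z /=.
      rewrite /hyperplane /= !dotvNl => /oppr_inj uz.
      exists (z - (b j - b i)); last by rewrite subrK.
      by rewrite !dotvDr !dotvNr !dotvDr !dotvNr uz; ring.
    case=> y; rewrite /hyperplane /= => yi <-.
    by rewrite !dotvNl !dotvDr !dotvNr yi; ring.
  move/seteqP => [/(_ (b i) erefl)]; rewrite /hyperplane /= !dotvNl => /oppr_inj uij _.
  have := face_opp_disjoint fX u0 iu; case/negP; move: ju => /faceNP[_ uj].
  by apply/faceNP; split=> [|l lX]; rewrite ?finset.inE // uij uj.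
have [u1 [c1 [u10 H1E _ le1]]] := S1; have [u2 [c2 [u20 H2E _ le2]]] := S2.
rewrite H1E H2E in par neq Hi Hj.
have [q u2E] := parallel_hyperplanes u10 Hi par.
have iu1 := support_face le1 Hi; have ju2 := support_face le2 Hj.
have [q0|q0|q0] := ltgtP q 0.
- exists u1 => //; split=> //.
  by move: ju2; rewrite u2E -[q *: u1]opprK -scaleNr -scalerN faceZ ?oppr_gt0.
- case: neq; move: ju2; rewrite u2E faceZ // => ju1.
  have c12 : c2 = q * c1.
    by rewrite -Hj u2E dotvZl -Hi (face_eq iu1 ju1).
  rewrite c12; apply/seteqP; split=> z; rewrite /hyperplane /= dotvZl; first by move=> ->.
  by move/(mulfI (lt0r_neq0 q0)).
- by move: u20; rewrite u2E q0 scale0r eqxx.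
Qed.

Lemma num_antipodal_pairsE : injective b -> full_dim b [set: I] ->
  num_antipodal_pairs X = #|opposite_pairs b [set: I]|.
Proof.
move=> binj fX; pose img (e : {set I}) := [fset b i | i in e]%fset.
have imgP (e : {set I}) i : (b i \in img e) = (i \in e) by rewrite mem_imfset.
have img_inj : injective img.
  by move=> e f ef; apply/setP => i; rewrite -!imgP ef.
have img2 i j : img [set i; j] = [fset b i; b j]%fset.
  apply/fsetP => x; rewrite !finmap.inE; apply/imfsetP/orP => /= [[l]|].
    by rewrite !finset.inE => /orP[]/eqP -> ->; rewrite eqxx; [left | right].
  by case=> /eqP ->; [exists i | exists j]; rewrite // !finset.inE eqxx ?orbT.
rewrite /num_antipodal_pairs.
suff -> : antipodal_pairs X = [fset img e | e in opposite_pairs b [set: I]]%fset.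
  by rewrite card_imfset //= -cardE.
apply/fsetP => Y; rewrite !finmap.inE; apply/andP/imfsetP => /= [[_ /asboolP]|[e]].
  move=> [x [y [-> xy]]]; have [/XP[i xi] /XP[j yj] _ _] := xy.
  rewrite xi yj -img2; exists [set i; j] => //.
  by apply/opposite_pairsP; exists i, j; split=> //; apply/oppositeP; rewrite -?xi -?yj.
move=> /opposite_pairsP[i [j [-> o]]] ->; split.
  by rewrite fpowersetE img2; apply/fsubsetP => x; rewrite !finmap.inE => /orP[]/eqP ->.
by apply/asboolP; exists (b i), (b j); split=> //; exact/oppositeP.
Qed.

End Antipodal.

Lemma num_antipodal_pairs_ge (R : realType) (d : nat) (X : {fset 'rV[R]_d}) :
  affine_hull X = setT -> convex_position X ->
  (#|` X| + 'C(d, 2) <= num_antipodal_pairs X + 1)%N.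
Proof.
move=> aff conv; pose b (i : X) : 'rV[R]_d := val i.
have XP x : reflect (exists i, x = b i) (x \in X).
  by apply: (iffP idP) => [xX|[i ->]]; [exists [` xX]%fset | exact: valP].
have fX := affine_hull_full_dim XP aff.
have binj : injective b by exact: val_inj.
rewrite (num_antipodal_pairsE XP) //.
have := opposite_pairs_bound fX.
(* Convex position makes every index extreme. *)
rewrite (_ : extreme b [set: X] = [set: X]) ?cardsT -?cardfE //.
apply/setP => i; rewrite !finset.inE; apply/asboolP.
have [u u0 ui] := boundary_support (valP i) (conv (val i) (valP i)).
by exists u => //; apply/faceP; split=> [|j _]; [rewrite finset.inE | exact/ui/valP].
Qed.

(** * The extremal configuration *)

Section Example.
Context {R : realType} (d n : nat).
Hypotheses (hd : (2 <= d)%N) (hn : (d < n)%N).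

(* For m > d: points of the relative interior of the facet opposite to the
   origin, so that the origin is their only antipode. *)
Definition example_pt (m : nat) : 'rV[R]_d :=
  \row_(j < d) (if m == 0%N then 0
                else if (m <= d)%N then (j.+1 == m)%:R
                else (if j == 0%N :> nat then m%:R else 1) / (m + d.-1)%:R).

Let pt (i : 'I_n) := example_pt i.

Lemma example_pt0 : example_pt 0 = 0.
Proof. by apply/rowP => j; rewrite !mxE. Qed.

Lemma example_ptS (j : 'I_d) : example_pt j.+1 = delta_mx ord0 j.
Proof. by apply/rowP => l; rewrite !mxE /= ltn_ord eqSS. Qed.

Lemma example_pt_gt0 m j : (d < m)%N -> 0 < example_pt m ord0 j.
Proof.
move=> dm; rewrite mxE gtn_eqF ?(leq_ltn_trans _ dm) // leqNgt dm /=.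
by rewrite divr_gt0 ?ltr0n ?addn_gt0 ?(leq_ltn_trans _ dm) //; case: ifP => // _;
  rewrite ltr0n (leq_ltn_trans _ dm).
Qed.

Lemma example_pt_ge0 m j : 0 <= example_pt m ord0 j.
Proof.
have [dm|] := ltnP d m; first by rewrite ltW ?example_pt_gt0.
by rewrite mxE => ->; case: ifP; rewrite ?ler0n.
Qed.

(** For [m] beyond [d] the numerators are [m] and [d.-1] ones, which add up to the denominator. *)
Lemma example_pt_sum m : (0 < m)%N -> \sum_(j < d) example_pt m ord0 j = 1.
Proof.
move=> m0; have [dm|md] := ltnP d m; last first.
  have m1d : (m.-1 < d)%N by rewrite prednK.
  rewrite -(prednK m0) -[m.-1]/(nat_of_ord (Ordinal m1d)) example_ptS.
  rewrite (bigD1 (Ordinal m1d)) //= big1 => [|j jm]; rewrite !mxE !eqxx ?addr0 //=.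
  by rewrite (negPf jm).
have -> : \sum_(j < d) example_pt m ord0 j =
    \sum_(j < d) (if j == 0%N :> nat then m%:R else 1) / (m + d.-1)%:R.
  by apply: eq_bigr => j _; rewrite mxE gtn_eqF // leqNgt dm.
have d0 : (0 < d)%N by exact: ltnW.
rewrite -mulr_suml (bigD1 (Ordinal d0)) //=.
have -> : \sum_(j < d | j != Ordinal d0) (if j == 0%N :> nat then m%:R else 1) = d.-1%:R :> R.
  rewrite (eq_bigr (fun=> 1)) => [|j]; last by rewrite -val_eqE /= => /negPf ->.
  rewrite sumr_const; congr (_ *+ _).
  by rewrite (cardC1 (Ordinal d0)) card_ord.
by rewrite -natrD divff // pnatr_eq0 -lt0n addn_gt0 m0.
Qed.

Lemma example_pt_inj : injective pt.
Proof.
move=> i j; rewrite /pt; wlog ij : i j / (i < j)%N.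
  move=> H e; have [ij|ji|/val_inj//] := ltngtP i j; first exact: H.
  by apply/esym/H.
move=> e; exfalso; have j0 : (0 < j)%N := leq_ltn_trans (leq0n i) ij.
have [i0|i0] := posnP i.
  have := example_pt_sum j0; rewrite -e i0 example_pt0 big1 => [/eqP|l _]; last by rewrite mxE.
  by rewrite eq_sym oner_eq0.
have [jd|dj] := leqP j d.
  have i1d : (i.-1 < d)%N by rewrite prednK // ltnW // (leq_trans ij).
  have /rowP/(_ (Ordinal i1d))/eqP := e; rewrite !mxE /= (gtn_eqF i0) (gtn_eqF j0) jd prednK //.
  by rewrite (leq_trans (ltnW ij) jd) eqxx (ltn_eqF ij) oner_eq0.
have [id|di] := leqP i d.
  (* As [2 <= d], a unit vector has a zero coordinate, unlike the points beyond [d]. *)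
  have [l li] : exists l : 'I_d, l.+1 != i.
    have [i1|i1] := eqVneq (i : nat) 1%N; first by exists (Ordinal hd); rewrite i1.
    by exists (Ordinal (ltnW hd)); rewrite eq_sym.
  have := example_pt_gt0 l dj; rewrite -e mxE (gtn_eqF i0) id (negPf li).
  by rewrite ltxx.
(* The coordinate of index 1 is the reciprocal of [m + d.-1] and determines [m]. *)
have /rowP/(_ (Ordinal hd))/eqP := e; rewrite !mxE /= (gtn_eqF i0) (gtn_eqF j0) (leqNgt i) (leqNgt j) di dj /=.
rewrite !div1r (inj_eq invr_inj) eqr_nat eqn_add2r => /eqP ij'.
by rewrite ij' ltnn in ij.
Qed.

Definition example_set : {fset 'rV[R]_d} := [fset pt i | i in 'I_n]%fset.

Lemma example_setP x : reflect (exists i, x = pt i) (x \in example_set).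
Proof.
apply: (iffP idP) => [/imfsetP[i _ ->]|[i ->]]; first by exists i.
by apply/imfsetP; exists i.
Qed.

Lemma example_card : #|` example_set| = n.
Proof. by rewrite card_imfset /= ?size_enum_ord //; exact: example_pt_inj. Qed.

Lemma mem_example m : (m <= d)%N -> example_pt m \in example_set.
Proof.
by move=> md; apply/example_setP; exists (Ordinal (leq_ltn_trans md hn)).
Qed.

Lemma example_affine : affine_hull example_set = setT.
Proof.
apply/seteqP; split=> // z _.
pose e (j : 'I_d) : 'rV[R]_d := delta_mx ord0 j.
have eX j : e j \in example_set by rewrite /e -example_ptS mem_example.
have oX : 0 \in example_set by rewrite -example_pt0 mem_example.
(* Barycentric coordinates: the origin takes the weight left over by the unit vectors. *)
pose c := 1 - \sum_(j < d) z ord0 j.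
exists (fun x => \sum_(j < d) z ord0 j * (x == e j)%:R + c * (x == 0)%:R); split.
  rewrite big_split /= -mulr_sumr fset_sum_eq1 // mulr1 exchange_big /=.
  under eq_bigr do rewrite -mulr_sumr fset_sum_eq1 // mulr1.
  by rewrite addrC subrK.
under eq_bigr do rewrite scalerDl scaler_suml -scalerA.
rewrite big_split /= -scaler_sumr (fset_sum_eq id) // scaler0 addr0 exchange_big /=.
under eq_bigr do under eq_bigr do rewrite -scalerA.
under eq_bigr do rewrite -scaler_sumr (fset_sum_eq id) //.
exact: row_sum_delta.
Qed.

Lemma dotv_const (c : R) m :
  dotv (const_mx c) (example_pt m) = if m == 0%N then 0 else c.
Proof.
case: eqP => [->|/eqP]; first by rewrite example_pt0 dotv0r.
rewrite -lt0n => /example_pt_sum sm.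
by rewrite -[RHS]mulr1 -sm mulr_sumr; apply: eq_bigr => j _; rewrite [in LHS]mxE.
Qed.

(** All points but the origin lie on the supporting hyperplane where the coordinate sum is 1; the
    parallel one through the origin supports the hull there. *)
Lemma example_convex : convex_position example_set.
Proof.
move=> x /= xX; have /example_setP[i xE] := xX.
have c0 (c : R) : c != 0 -> (const_mx c : 'rV[R]_d) != 0.
  move=> c_neq0; apply/eqP => /rowP/(_ (Ordinal hd))/eqP.
  by rewrite !mxE (negPf c_neq0).
have [i0|i0] := eqVneq (i : nat) 0%N.
  apply: (@support_boundary R d _ (const_mx (-1))) => // [|_ /example_setP[j ->]].
    by apply: c0; rewrite oppr_eq0 oner_eq0.
  by rewrite xE !dotv_const i0; case: ifP; rewrite ?lerN10.
apply: (@support_boundary R d _ (const_mx 1)) => // [|_ /example_setP[j ->]].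
  by apply: c0; rewrite oner_eq0.
by rewrite xE !dotv_const (negPf i0); case: ifP; rewrite ?ler01.
Qed.

(** A functional maximal at a relative interior point of the facet is constant on the facet, hence a
    positive multiple of the coordinate sum, which is minimal only at the origin. *)
Lemma example_opposite (i j : 'I_n) : (d < i)%N ->
  opposite pt [set: 'I_n] i j -> j = 0%N :> nat.
Proof.
move=> di [u u0 [/faceP[_ iu] /faceNP[_ ju]]].
have leM m : (m <= d)%N -> dotv u (example_pt m) <= dotv u (pt i).
  by move=> md; apply: (iu (Ordinal (leq_ltn_trans md hn))); rewrite finset.inE.
have geM m : (m <= d)%N -> dotv u (pt j) <= dotv u (example_pt m).
  by move=> md; apply: (ju (Ordinal (leq_ltn_trans md hn))); rewrite finset.inE.
set M := dotv u (pt i) in iu leM.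
have u_le l : u ord0 l <= M.
  have := leM l.+1 (ltn_ord l); rewrite example_ptS /dotv (bigD1 l) //= big1.
    by rewrite addr0 mxE !eqxx mulr1.
  by move=> m ml; rewrite mxE eqxx (negPf ml) mulr0.
have u_eq l : u ord0 l = M.
  have : \sum_(l < d) (M - u ord0 l) * pt i ord0 l == 0.
    rewrite (_ : \sum_l _ = M * (\sum_l pt i ord0 l) - dotv u (pt i)).
      by rewrite example_pt_sum ?(leq_ltn_trans (leq0n d)) // mulr1 subrr.
    by rewrite mulr_sumr -sumrB; apply: eq_bigr => m _; rewrite mulrBl.
  rewrite psumr_eq0 => [/allP/(_ l)|m _]; last by rewrite mulr_ge0 ?subr_ge0 ?example_pt_ge0.
  rewrite mem_index_enum mulf_eq0 [pt i ord0 l == 0]gt_eqF ?example_pt_gt0 // orbF.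
  by move=> /(_ isT); rewrite subr_eq0 => /eqP.
have uM : u = const_mx M by apply/rowP => l; rewrite mxE u_eq.
have M0 : M != 0.
  by apply: contraNneq u0 => M0; rewrite uM M0; apply/eqP/rowP => l; rewrite !mxE.
have Mgt0 : 0 < M by have := leM 0%N isT; rewrite example_pt0 dotv0r lt_neqAle eq_sym M0.
apply/eqP; apply: contraTT Mgt0 => j0; have := geM 0%N isT.
by rewrite example_pt0 dotv0r uM dotv_const (negPf j0) -leNgt.
Qed.

(** At most all pairs among the [d.+1] simplex vertices occur, and one pair with the origin for each
    further point. *)
Lemma example_count : (num_antipodal_pairs example_set <= 'C(d.+1, 2) + (n - d.+1))%N.
Proof.
have fX := affine_hull_full_dim example_setP example_affine.
rewrite (num_antipodal_pairsE example_setP example_pt_inj fX).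
pose o : 'I_n := Ordinal (leq_ltn_trans (leq0n d) hn).
pose S := [set i : 'I_n | (i < d.+1)%N].
have S_card : #|S| = d.+1.
  rewrite (_ : S = [set widen_ord hn i | i in [set: 'I_d.+1]]).
    rewrite card_imset; first by rewrite cardsT card_ord.
    by move=> i j /(congr1 val) /= ij; exact: val_inj.
  apply/setP => i; rewrite finset.inE; apply/idP/imsetP => [id|[j _ ->]].
    by exists (Ordinal id); [rewrite finset.inE | exact: val_inj].
  exact: (ltn_ord j).
have sub : opposite_pairs pt [set: 'I_n] \subset
    [set A : {set 'I_n} | A \subset S & #|A| == 2] :|: [set [set i; o] | i in ~: S].
  apply/fintype.subsetP => e /opposite_pairsP[i [j [-> oij]]].
  have star (k l : 'I_n) : (d < k)%N -> opposite pt [set: 'I_n] k l ->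
      [set k; l] \in [set [set i; o] | i in ~: S].
    move=> dk okl; apply/imsetP; exists k; first by rewrite !finset.inE -leqNgt.
    by congr [set k; _]; apply: val_inj; rewrite /= (example_opposite dk okl).
  rewrite finset.in_setU; have [di|id] := ltnP d i; first by rewrite star ?orbT.
  have [dj|jd] := ltnP d j.
    by rewrite finset.setUC star ?orbT //; exact: oppositeC.
  rewrite finset.inE finset.subUset !finset.sub1set !finset.inE !ltnS id jd /=.
  by rewrite cards2 (opposite_neq fX oij).
apply: leq_trans (subset_leq_card sub) _; apply: leq_trans (leq_card_setU _ _) _.
rewrite cards_draws S_card leq_add2l; apply: leq_trans (leq_imset_card _ _) _.
by rewrite cardsCs finset.setCK S_card card_ord.
Qed.

End Example.

Local Open Scope classical_set_scope.

Theorem theorem1p2 (R : realType) (d n : nat) (hd : (2 <= d)%N)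
    (hn : (d + 1 <= n)%N) :
  is_minimum
    [set num_antipodal_pairs X | X in
       [set X : {fset 'rV[R]_d} |
          [/\ affine_hull X = setT, convex_position X & #|` X| = n]]]
    (n + (d * (d - 1)) %/ 2 - 1)%N.
Proof.
have -> : ((d * (d - 1)) %/ 2 = 'C(d, 2))%N by rewrite bin2 subn1 divn2.
have lower (X : {fset 'rV[R]_d}) : affine_hull X = setT -> convex_position X ->
    #|` X| = n -> (n + 'C(d, 2) - 1 <= num_antipodal_pairs X)%N.
  by move=> aff conv <-; have := num_antipodal_pairs_ge aff conv; lia.
have dn : (d < n)%N by rewrite -addn1.
split; last by move=> _ [X [aff conv Xn] <-]; exact: lower.
have aff := @example_affine R d n dn.
have conv := @example_convex R d n hd.
have card := @example_card R d n hd.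
exists (example_set d n) => //; apply/eqP; rewrite eqn_leq lower // andbT.
(* Pascal's rule turns ['C(d.+1, 2)] into ['C(d, 2) + d]. *)
have := example_count hd dn; rewrite binS bin1 => /(_ R); lia.
Qed.
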